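(* Let $\ell_1,\ell_2\in\mathbb{N}\setminus\{1\}$ satisfy $\gcd(\ell_1,\ell_2)=1$, and let $p(x,y):=x^{\ell_1}y^{\ell_2}-1$. Then, for every $n\ge\ell_1+\ell_2$, the generator family $\{1,p,-p\}$ satisfies property $(S_{n,\ell_1+\ell_2-1})$.
   Context: Here $\mathbb{N}=\{1,2,\ldots\}$, $\mathbb{N}_0=\mathbb{N}\cup\{0\}$, $\mathcal{P}_m=\{f\in\mathbb{R}[x,y]:\deg f\le m\}$, and $\mathcal{Z}_p=\{(x,y)\in\mathbb{R}^2:p(x,y)=0\}$. A truncated (bivariate) sequence of degree $2n$ is a family of real numbers $\beta\equiv\beta^{(2n)}=\{\beta_{i,j}\}_{i,j\in\mathbb{N}_0,\,i+j\le 2n}$. Its Riesz functional is the linear map $L_\beta:\mathcal{P}_{2n}\to\mathbb{R}$ with $L_\beta(x^iy^j)=\beta_{i,j}$. Let $\mathcal{B}_m$ denote the set of monomials of degree at most $m$. The moment matrix $M(n)\equiv M(n;\beta)$ is the symmetric matrix indexed by $\mathcal{B}_n\times\mathcal{B}_n$ whose entry at monomials $(u,v)$ is $L_\beta(uv)$. For a polynomial $q$ of degree $\delta\le 2n$, the localizing matrix $M_q(n)\equiv M_q(n;\beta)$ is the symmetric matrix indexed by $\mathcal{B}_{n-\lceil\delta/2\rceil}\times\mathcal{B}_{n-\lceil\delta/2\rceil}$ whose entry at $(u,v)$ is $L_\beta(quv)$. For $k\in\mathbb{N}_0$, a positive extension of $M(n)$ of order $n+k$ is a moment matrix $M(n+k)\succeq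 0$ (of some truncated sequence of degree $2(n+k)$) whose principal submatrix indexed by $\mathcal{B}_n$ equals $M(n)$. Let $Q=\{q_0:=1,q_1,\ldots,q_m\}\subset\mathbb{R}[x,y]$ and $K_Q=\{z\in\mathbb{R}^2:q_i(z)\ge 0,\ i=0,\ldots,m\}$. A $K_Q$-representing measure for $\beta^{(2n)}$ is a positive Borel measure $\mu$ on $\mathbb{R}^2$ supported on $K_Q$ with $\beta_{i,j}=\int x^iy^j\,d\mu$ for all $i+j\le 2n$. The family $Q$ satisfies property $(S_{n,k})$ if, for every truncated sequence $\beta^{(2n)}$ of degree $2n$: $\beta^{(2n)}$ has a $K_Q$-representing measure if and only if $M(n)$ admits a positive extension $M(n+k)$ such that $M_{q_i}(n+k)\succeq 0$ for $i=1,\ldots,m$. For $Q=\{1,p,-p\}$ one has $K_Q=\mathcal{Z}_p$. *)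

(* Defs.v *)
From HB Require Import structures.
From mathcomp Require Import all_boot all_order all_algebra.
From mathcomp Require Import all_classical all_reals all_analysis.
(* Some notations of mpoly.v clash with those of MathComp-Analysis. *)
From mathcomp Require mpoly.
Import -(notations) mpoly.

Set Implicit Arguments.
Unset Strict Implicit.
Unset Printing Implicit Defensive.

Import Order.TTheory GRing.Theory Num.Theory.
Import numFieldNormedType.Exports.

Local Open Scope classical_set_scope.
Local Open Scope ring_scope.

(* R[x, y], with x the variable of index 0 and y the variable of index 1. *)
Notation poly2 R := (mpoly 2 R).

Definition varx (R : realType) : poly2 R := mpolyX R (mnm1 (ord0 : 'I_2)).

Definition vary (R : realType) : poly2 R := mpolyX R (mnm1 (ord_max : 'I_2)).

(* Total degree; it is 0 on the zero polynomial. *)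
Definition deg2 (R : realType) (q : poly2 R) : nat :=
  (mmeasure (@mdeg 2) q).-1.

Definition eval2 (R : realType) (q : poly2 R) (z : R * R) : R :=
  meval (tnth [tuple z.1; z.2]) q.

(* The set B_m of (exponents of) bivariate monomials of degree at most m. *)
Notation mon m := (bmultinom 2 m.+1).

Definition mon_poly (R : realType) (m : nat) (u : mon m) : poly2 R :=
  mpolyX R u.

Definition tseq (R : realType) (n : nat) := mon (2 * n) -> R.

(* Only the coefficients of degree at most 2n are read, so that this is the
   Riesz functional on P_2n, extended by 0 on the monomials of higher degree. *)
Definition riesz (R : realType) (n : nat) (b : tseq R n) (q : poly2 R) : R :=
  \sum_(m : mon (2 * n)) mcoeff m q * b m.

Definition moment_mx (R : realType) (n : nat) (b : tseq R n) :
    'M[R]_(#|{: mon n}|) :=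
  \matrix_(i, j) riesz b (mon_poly R (enum_val i) * mon_poly R (enum_val j)).

(* Meaningful for deg2 q <= 2n only; uphalf is the half rounded up. *)
Definition localizing_mx (R : realType) (n : nat) (b : tseq R n) (q : poly2 R) :
    'M[R]_(#|{: mon (n - uphalf (deg2 q))}|) :=
  \matrix_(i, j) riesz b (q * mon_poly R (enum_val i) * mon_poly R (enum_val j)).

Definition psd (R : realType) (d : nat) (A : 'M[R]_d) : Prop :=
  A^T = A /\ forall v : 'rV[R]_d, 0 <= (v *m A *m v^T) ord0 ord0.

Definition mon_widen (n k : nat) (u : mon n) : mon (n + k) :=
  BMultinom (leq_trans (bmdeg u) (leq_addr k n : (n.+1 <= (n + k).+1)%N)).

Definition positive_extension (R : realType) (n k : nat)
    (b : tseq R n) (b' : tseq R (n + k)) : Prop :=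
  let f (i : 'I_(#|{: mon n}|)) := enum_rank (mon_widen k (enum_val i)) in
  psd (moment_mx b') /\ mxsub f f (moment_mx b') = moment_mx b.

(* The plane with its Borel sigma-algebra. *)
Definition borel2 (R : realType) :=
  g_sigma_algebraType (@open (R * R)%type).

Definition KQ (R : realType) (Q : seq (poly2 R)) : set (borel2 R) :=
  [set z | forall q, q \in Q -> 0 <= eval2 q z].

(* K_Q is closed, so that mu is supported on it iff its complement is null. *)
Definition representing_measure (R : realType) (Q : seq (poly2 R)) (n : nat)
    (b : tseq R n) (mu : {measure set (borel2 R) -> \bar R}) : Prop :=
  mu (~` KQ Q) = 0%E /\
  forall m : mon (2 * n),
    mu.-integrable setT (fun z : borel2 R => (eval2 (mon_poly R m) z)%:E) /\
    (\int[mu]_z (eval2 (mon_poly R m) z)%:E)%E = (b m)%:E.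

(* Property (S_{n,k}) for a family Q = [:: q_0; q_1; ...; q_m] with q_0 = 1. *)
Definition property_S (R : realType) (Q : seq (poly2 R)) (n k : nat) : Prop :=
  forall b : tseq R n,
    (exists mu : {measure set (borel2 R) -> \bar R},
        representing_measure Q b mu) <->
    (exists b' : tseq R (n + k),
        positive_extension b b' /\
        forall i, (0 < i < size Q)%N -> psd (localizing_mx b' Q`_i)).

(* Main.v *)
Require Import Defs.
From HB Require Import structures.
From mathcomp Require Import all_boot all_order all_algebra ring lra zify.
From mathcomp Require Import all_classical all_reals all_analysis.
From mathcomp Require Import measurable_realfun.
From mathcomp Require mpoly complex.
Import -(notations) mpoly.
Import -(notations) complex.

(** Since [l1] and [l2] are coprime, [t |-> (t ^ l2, t ^ (- l1))] is a bijection
from the nonzero reals onto the curve [x ^ l1 * y ^ l2 = 1]; its inverse is a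
monomial [t = x ^ u * y ^ v], where [u * l2 = v * l1 + 1]. On the curve
[x ^ i * y ^ j] is the Laurent monomial [t ^ (l2 * i - l1 * j)], so a sequence
[b] of degree [2n] becomes, after multiplication by [t ^ (2 * n * l1)], a
truncated moment problem on the line for the polynomials in [t] of degree at
most [2d], [d = n * (l1 + l2)], with the constraint that 0 must not be an atom.

Both sides of the equivalence are shown to hold exactly when [b] comes from
finitely many weighted points of the curve ([atomic_on]). Such a sequence has
moments of all orders, which give the extension ([atomic_property]), and a sum
of Dirac masses represents it ([atomic_representing]). The two other
implications reduce to one theorem on the line, [truncated_moments_atomic]:
let [L] be nonnegative on the squares [g ^ 2] with [deg g <= d], and call [g]
isotropic when [L (g ^ 2) = 0]. If isotropic polynomials annihilate everything
up to degree [2d], and if ['X * g] isotropic forces [g] isotropic, then [L] is a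
quadrature with nonnegative weights at nonzero nodes. The nodes are the roots
of an isotropic polynomial of least degree if there is one, and otherwise of a
polynomial of degree [d + 1] orthogonal to degrees below [d]: there is one
degree of freedom in it, enough to avoid the root 0. That such polynomials have
only simple real roots is seen by factoring out an irreducible quadratic or a
square ([orthogonal_splits]).

For a representing measure ([measure_atomic]) an isotropic polynomial vanishes
almost everywhere in the variable [t], and [t] is never 0, which gives the two
conditions at once. For a positive extension ([extension_atomic]) positivity of
both localizing matrices makes the functional vanish on multiples of
[x ^ l1 * y ^ l2 - 1], so that it depends on [l2 * i - l1 * j] only. The order
of the extension lets every exponent from [- (n * l1 + 1)] to [n * l2 + 1] be
written as [l2 * i - l1 * j] with [i + j] small enough ([exponent_pair]; the
bounds [2 <= l1] and [2 <= l2] are used there). The functional on the line is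
thus nonnegative on squares with one more power of [t] on each side than
needed, and by the Cauchy-Schwarz argument this margin yields the two conditions
([extended_moments_atomic]). *)

Set Implicit Arguments.
Unset Strict Implicit.
Unset Printing Implicit Defensive.

Import Order.TTheory GRing.Theory Num.Theory.
Import numFieldNormedType.Exports.

Local Open Scope ring_scope.

(** * Gauss quadrature for positive definite functionals *)

(** A nonreal root [a + i b] over the algebraic closure makes the real quadratic
[('X - a) ^ 2 + b ^ 2] a factor, because the remainder of degree at most one
vanishes at that root. So forbidding these factors leaves only real roots. *)
Lemma rcf_poly_splits (R : rcfType) (f : {poly R}) : f \is monic ->
  (forall a b g, b != 0 -> f != (('X - a%:P) ^+ 2 + (b ^+ 2)%:P) * g) ->
  exists xs : seq R, f = \prod_(x <- xs) ('X - x%:P).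
Proof.
move=> fmon noquad.
pose rc : {rmorphism R -> complex.complex R} := complex.real_complex R.
have [zs fzs] := closed_field_poly_normal (map_poly rc f).
move: fzs; rewrite lead_coef_map (monicP fmon) rmorph1 scale1r => fzs.
have re z : z \in zs -> z = rc (complex.Re z).
  case: z => a b zin; congr complex.Complex; apply/eqP/negP => /negP b0 /=.
  set q := ('X - a%:P) ^+ 2 + (b ^+ 2)%:P.
  have qmon : q \is monic.
    rewrite monicE lead_coefDl ?lead_coef_exp ?lead_coefXsubC ?expr1n //.
    by rewrite size_exp_XsubC size_polyC; case: (_ == _).
  have sq : size q = 3%N.
    by rewrite size_polyDl size_exp_XsubC // size_polyC; case: (_ == _).
  set z := complex.Complex a b in zin.
  have qz : (map_poly rc q).[z] = 0.
    rewrite /q rmorphD rmorphXn rmorphB /= map_polyX !map_polyC /= !hornerE.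
    rewrite /z /rc /=; apply/eqP; rewrite complex.eq_complex /=.
    by rewrite !expr2 /= subrr !subr0 !mul0r mulr0 sub0r addNr !addr0 eqxx.
  have fz : (map_poly rc f).[z] = 0.
    by apply/rootP; rewrite fzs root_prod_XsubC.
  have := divp_eq f q; set g := f %/ q; set s := f %% q => feq.
  have ss : (size s <= 2)%N.
    by rewrite -ltnS -sq ltn_modp monic_neq0.
  have sz : (map_poly rc s).[z] = 0.
    by move: fz; rewrite feq rmorphD rmorphM /= !hornerE qz mulr0 add0r.
  have s0 : s = 0.
    have [c [e se]] : exists c e, s = c%:P * 'X + e%:P.
      exists s`_1, s`_0; apply/polyP => -[|[|i]]; rewrite coefD coefCM coefX !coefC ?mulr0 ?mulr1 ?add0r ?addr0 //=.
      by rewrite nth_default // (leq_trans ss).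
    move: sz; rewrite se rmorphD rmorphM /= map_polyX !map_polyC /= !hornerE.
    rewrite /z /rc /= => /eqP; rewrite complex.eq_complex /=.
    rewrite !mul0r subr0 !addr0 => /andP[/eqP ca /eqP cb].
    have c0 : c = 0 by move/eqP: cb; rewrite mulf_eq0 (negPf b0) orbF => /eqP.
    by move: ca; rewrite c0 mul0r add0r => ->; rewrite mul0r add0r.
  by move: (noquad a b g b0); rewrite {1}feq s0 addr0 mulrC eqxx.
exists (map (@complex.Re R) zs).
apply: (map_poly_inj rc); rewrite fzs rmorph_prod big_map /=.
rewrite big_seq [RHS]big_seq; apply: eq_bigr => z /re {1}->.
by rewrite rmorphB /= map_polyX map_polyC.
Qed.

Definition posdef (R : rcfType) (L : {scalar {poly R}}) (m : nat) :=
  forall g : {poly R}, g != 0 -> (size g <= m)%N -> 0 < L (g ^+ 2).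

Lemma posdef_ge0 (R : rcfType) (L : {scalar {poly R}}) m (g : {poly R}) :
  posdef L m -> (size g <= m)%N -> 0 <= L (g ^+ 2).
Proof.
move=> Lpos sg; have [->|g0] := eqVneq g 0; first by rewrite expr0n linear0.
exact/ltW/Lpos.
Qed.

Lemma not_uniq_perm (T : eqType) (s : seq T) :
  ~~ uniq s -> exists x t, perm_eq s [:: x, x & t].
Proof.
elim: s => //= a s IH; rewrite negb_and negbK => /orP[ain|/IH[x [t st]]].
  by exists a, (rem a s); rewrite perm_cons perm_to_rem.
exists x, (a :: t); rewrite (perm_trans (y := [:: a, x, x & t])) ?perm_cons //.
by apply/permPl; exact: (perm_catCA [:: a] [:: x; x] t).
Qed.

(** If [f = (('X - a) ^ 2 + b ^ 2) * g], where [b] may be 0, then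
[L (f * g) = L ((('X - a) * g) ^ 2) + b ^ 2 * L (g ^ 2)] is positive, whereas
orthogonality makes it 0. The case [b != 0] excludes nonreal roots, the case
[b = 0] excludes multiple ones. *)
Lemma orthogonal_splits (R : rcfType) (L : {scalar {poly R}}) r (f : {poly R}) :
  posdef L r -> f \is monic -> size f = r.+1 ->
  (forall h : {poly R}, (size h <= r)%N -> L (f * h) = 0) ->
  exists xs : seq R, uniq xs /\ f = \prod_(x <- xs) ('X - x%:P).
Proof.
move=> Lpos fmon sf orth.
have f0 : f != 0 by rewrite -size_poly_eq0 sf.
have noquad a (b : R) (g : {poly R}) : f = (('X - a%:P) ^+ 2 + (b ^+ 2)%:P) * g -> False.
  move=> fE.
  have g0 : g != 0 by apply: contra_neq f0 => g0; rewrite fE g0 mulr0.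
  have sg : (size g).+1 = r.
    have := sf; rewrite fE size_monicM //; last first.
      rewrite monicE lead_coefDl ?lead_coef_exp ?lead_coefXsubC ?expr1n //.
      by rewrite size_exp_XsubC size_polyC; case: (_ == _).
    rewrite size_polyDl size_exp_XsubC; last by rewrite size_polyC; case: (_ == _).
    by rewrite addSn /= => -[].
  have : L (f * g) = 0 by apply: orth; rewrite -sg.
  have -> : f * g = (('X - a%:P) * g) ^+ 2 + (b ^+ 2) *: (g ^+ 2).
    by rewrite fE -mul_polyC; ring.
  rewrite linearD linearZ /=; apply/eqP; rewrite gt_eqF // ltr_pwDl //.
    apply: Lpos; first by rewrite mulf_neq0 // polyXsubC_eq0.
    by rewrite size_monicM ?monicXsubC // size_XsubC; lia.
  by rewrite mulr_ge0 ?sqr_ge0 // (posdef_ge0 Lpos) //; lia.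
have [xs fxs] : exists xs : seq R, f = \prod_(x <- xs) ('X - x%:P).
  apply: rcf_poly_splits => // a b g b0; apply/eqP; exact: noquad.
exists xs; split=> //.
apply: contraT => /not_uniq_perm[x [t xt]]; exfalso.
apply: (@noquad x 0 (\prod_(z <- t) ('X - z%:P))).
by rewrite expr0n /= addr0 fxs (perm_big _ xt) !big_cons expr2 -mulrA.
Qed.

(** The weight at a node is [L l = L (l ^ 2)], with [l] the Lagrange polynomial of
that node: [l - l ^ 2] vanishes at all nodes, hence is a multiple of [f] by a
cofactor of low degree, and [L] kills it. Exactness up to twice the number of
nodes has the same reason. *)
Lemma Gauss_quadrature (R : rcfType) (L : {scalar {poly R}}) r (f : {poly R}) :
  posdef L r -> f \is monic -> size f = r.+1 ->
  (forall h : {poly R}, (size h <= r)%N -> L (f * h) = 0) ->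
  exists (xs : seq R) (w : R -> R),
    [/\ all (root f) xs, (forall x, x \in xs -> 0 <= w x) &
        forall g : {poly R}, (size g <= r.*2)%N -> L g = \sum_(x <- xs) w x * g.[x]].
Proof.
move=> Lpos fmon sf orth.
have [xs [uxs fE]] := orthogonal_splits Lpos fmon sf orth.
have sxs : size xs = r by have := sf; rewrite fE size_prod_XsubC => -[].
have Lvanish (g : {poly R}) : (size g <= r.*2)%N -> {in xs, forall x, g.[x] = 0} -> L g = 0.
  move=> sg gxs.
  have /dvdpP[q gq] : f %| g.
    rewrite fE; apply: uniq_roots_dvdp; last by rewrite uniq_rootsE.
    by apply/allP => x /gxs gx; apply/rootP.
  have [q0|q0] := eqVneq q 0; first by rewrite gq q0 mul0r linear0.
  rewrite gq mulrC orth //; move: sg.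
  by rewrite gq mulrC size_monicM // sf; lia.
pose q x : {poly R} := \prod_(y <- rem x xs) ('X - y%:P).
pose l x : {poly R} := (q x).[x]^-1 *: q x.
have sl x : x \in xs -> (size (l x) <= r)%N.
  move=> xin; rewrite (leq_trans (size_scale_leq _ _)) //.
  rewrite size_prod_XsubC size_rem // sxs prednK // -sxs.
  by case: (xs) xin.
have lE x y : x \in xs -> y \in xs -> (l x).[y] = (y == x)%:R.
  move=> xin yin; rewrite hornerZ.
  have qx z : (q x).[z] = \prod_(y <- rem x xs) (z - y).
    by rewrite horner_prod; apply: eq_bigr => i _; rewrite hornerXsubC.
  have [->|yx] := eqVneq y x.
    rewrite mulVf // qx prodf_seq_neq0; apply/allP => z.
    rewrite mem_rem_uniq // inE => /andP[zx _] /=.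
    by rewrite subr_eq0 eq_sym.
  rewrite [X in _ * X]qx (big_rem y) /= ?subrr ?mul0r ?mulr0 //.
  by rewrite mem_rem_uniq // inE yx.
clearbody l; exists xs, (fun x => L (l x)); split.
- by apply/allP => x xin; rewrite fE root_prod_XsubC.
- move=> x xin; rewrite -[l x](subrKC (l x ^+ 2)) linearD /= [L (l x - _)]Lvanish ?addr0.
  + by rewrite (posdef_ge0 Lpos) // sl.
  + rewrite (leq_trans (size_polyD _ _)) // size_polyN geq_max.
    have := sl x xin => slx; apply/andP; split.
      by rewrite -addnn (leq_trans slx) ?leq_addl.
    rewrite expr2 (leq_trans (size_polyMleq _ _)) // (leq_trans (leq_pred _)) //.
    by rewrite -addnn leq_add.
  + move=> y yin; rewrite hornerD hornerN !hornerE lE //.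
    by case: (_ == _); rewrite ?expr1n ?expr0n subrr.
- move=> g sg; apply/eqP; rewrite -subr_eq0; apply/eqP.
  have -> : L g - \sum_(x <- xs) L (l x) * g.[x] =
            L (g - \sum_(x <- xs) g.[x] *: l x).
    rewrite linearB [in RHS]linear_sum /=; congr (_ - _); apply: eq_bigr => x _.
    by rewrite linearZ /= mulrC.
  apply: Lvanish.
    rewrite (leq_trans (size_polyD _ _)) // size_polyN geq_max sg /=.
    rewrite (leq_trans (size_sum _ _ _)) //.
    rewrite big_seq; apply/bigmax_leqP_seq => x xin _.
    rewrite (leq_trans (size_scale_leq _ _)) //.
    by have := sl x xin; lia.
  move=> y yin; rewrite hornerD hornerN horner_sum.
  rewrite (bigD1_seq y) //= big_seq_cond big1 ?addr0.
    by rewrite hornerZ lE // eqxx mulr1 subrr.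
  by move=> x /andP[xin xy]; rewrite hornerZ lE // eq_sym (negPf xy) mulr0.
Qed.

(** * Truncated functionals represented by nonzero nodes *)

Lemma scalar_mul_poly (R : comNzRingType) (L : {scalar {poly R}})
    (p h : {poly R}) :
  L (p * h) = \sum_(j < size h) h`_j * L (p * 'X^j).
Proof.
rewrite -{1}[h]coefK poly_def mulr_sumr linear_sum /=.
by apply: eq_bigr => j _; rewrite -scalerAr linearZ.
Qed.

Lemma scalar_shift_coef (R : comNzRingType) (L : {scalar {poly R}}) c k :
  exists L' : {scalar {poly R}}, forall g : {poly R}, L' g = L g + c * g`_k.
Proof.
have lin : scalar (fun g : {poly R} => L g + c * g`_k).
  by move=> a g h; rewrite linearP coefD coefZ; ring.
pose lin' := GRing.isLinear.Build R {poly R} R *%R _ lin.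
pose L' : {scalar {poly R}} := HB.pack (fun g : {poly R} => L g + c * g`_k) lin'.
by exists L'.
Qed.

(** A truncated functional is encoded as a total one, so that linearity holds
without degree conditions; monomials of degree [m] or more are sent to 0. *)
Lemma scalar_of_moments (R : comNzRingType) (s : nat -> R) m :
  exists L : {scalar {poly R}}, forall k, (k < m)%N -> L 'X^k = s k.
Proof.
have lin : scalar (fun g : {poly R} => \sum_(k < m) g`_k * s k).
  move=> a g h; rewrite mulr_sumr -big_split; apply: eq_bigr => k _ /=.
  by rewrite coefD coefZ; ring.
pose lin' := GRing.isLinear.Build R {poly R} R *%R _ lin.
pose L : {scalar {poly R}} := HB.pack (fun g : {poly R} => \sum_(k < m) g`_k * s k) lin'.
exists L => k km; rewrite /L /= (bigD1 (Ordinal km)) //= coefXn eqxx mul1r.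
rewrite big1 ?addr0 // => i ik.
by rewrite coefXn (_ : (i == k :> nat) = false) ?mul0r //; apply/negbTE: ik.
Qed.

(** The Hankel matrix of a positive definite functional is invertible, since a
vector in its kernel is an isotropic polynomial. *)
Lemma orthogonal_projection (R : rcfType) (L : {scalar {poly R}}) m
    (q : {poly R}) : posdef L m ->
  exists g : {poly R}, (size g <= m)%N /\
    forall h : {poly R}, (size h <= m)%N -> L ((q - g) * h) = 0.
Proof.
move=> Lpos; pose H : 'M[R]_m := \matrix_(i, j) L ('X^i * 'X^j).
have LH (v : 'rV_m) (j : 'I_m) : L (rVpoly v * 'X^j) = (v *m H) 0 j.
  rewrite mxE {1}(row_sum_delta v) linear_sum mulr_suml linear_sum /=.
  apply: eq_bigr => i _.
  by rewrite linearZ /= rVpoly_delta -scalerAl linearZ mxE.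
have Lmul (p h : {poly R}) : (forall j : 'I_m, L (p * 'X^j) = 0) ->
    (size h <= m)%N -> L (p * h) = 0.
  move=> pX sh; rewrite scalar_mul_poly big1 // => j _.
  by have := pX (widen_ord sh j) => /= ->; rewrite mulr0.
have Hunit : H \in unitmx.
  rewrite -row_free_unit; apply: inj_row_free => v vH.
  apply/eqP; apply: contraT => v0.
  suff : L (rVpoly v ^+ 2) = 0.
    move=> /eqP; rewrite gt_eqF //; apply: Lpos; last exact: size_poly.
    by apply: contra_neq v0 => v0; rewrite -(rVpolyK v) v0 linear0.
  by rewrite expr2 Lmul ?size_poly // => j; rewrite LH vH mxE.
pose v := \row_j L (q * 'X^j) *m invmx H.
exists (rVpoly v); split; first exact: size_poly.
move=> h; apply: Lmul => j.
by rewrite mulrBl linearB /= LH mulmxKV // mxE subrr.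
Qed.

(** In the second case [f] has least degree among the isotropic polynomials, since
[L] is positive definite below it. *)
Lemma posdef_or_kernel (R : rcfType) (L : {scalar {poly R}}) m :
  (forall g : {poly R}, (size g <= m)%N -> 0 <= L (g ^+ 2)) ->
  posdef L m \/
  exists (f : {poly R}) r, [/\ f \is monic, size f = r.+1, (r < m)%N,
    L (f ^+ 2) = 0 & posdef L r].
Proof.
elim: m => [|m IH] Lge0.
  by left=> g g0; rewrite leqn0 size_poly_eq0 (negPf g0).
have [|Lpos|[f [r [fm sf rm Lf Lr]]]] := IH; first by move=> g sg; apply: Lge0; lia.
  have [[f [sf Lf]]|nof] := EM (exists f : {poly R}, size f = m.+1 /\ L (f ^+ 2) = 0).
    right; exists ((lead_coef f)^-1 *: f), m.
    have lf : lead_coef f != 0 by rewrite lead_coef_eq0 -size_poly_eq0 sf.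
    split=> //; first by rewrite monicE lead_coefZ mulVf.
      by rewrite size_scale ?invr_eq0.
    by rewrite exprZn linearZ /= Lf mulr0.
  left=> g g0 sg; have [sgm|sgm] := leqP (size g) m; first exact: Lpos.
  rewrite lt0r Lge0 // andbT; apply/eqP => Lg; apply: nof.
  by exists g; split=> //; apply/eqP; rewrite eqn_leq sg.
by right; exists f, r; split=> //; lia.
Qed.

Lemma size_monicB (R : nzRingType) (p q : {poly R}) n : p \is monic ->
  q \is monic -> size p = n.+1 -> size q = n.+1 -> (size (p - q)%R <= n)%N.
Proof.
move=> pm qm sp sq; apply/leq_sizeP => j; rewrite coefB leq_eqVlt => /orP[/eqP<-|nj].
  have -> : p`_n = 1 by rewrite -(monicP pm) lead_coefE sp.
  by rewrite -(monicP qm) lead_coefE sq subrr.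
by rewrite !nth_default ?subrr ?sp ?sq.
Qed.

(** With [P] and [Q] the orthogonal polynomials of degrees [d] and [d + 1], both [Q]
and [Q + P] are suitable except for the value at 0, which differs unless
[P 0 = 0]. They cannot both vanish at 0: if [P = u * 'X] and [Q = v * 'X], then
[P * v = Q * u], where [L (P * v) = L (P ^ 2) > 0] and [L (Q * u) = 0]. *)
Lemma orthogonal_nonroot (R : rcfType) (L : {scalar {poly R}}) d :
  posdef L d.+1 ->
  exists f : {poly R}, [/\ f \is monic, size f = d.+2, ~~ root f 0 &
    forall h : {poly R}, (size h <= d)%N -> L (f * h) = 0].
Proof.
move=> Lpos.
have Lposd : posdef L d by move=> g g0 sg; apply: Lpos => //; lia.
have [g [sg gorth]] := orthogonal_projection 'X^d Lposd.
have [g' [sg' g'orth]] := orthogonal_projection 'X^(d.+1) Lposd.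
set P := 'X^d - g in gorth; set Q := 'X^(d.+1) - g' in g'orth.
have sP : size P = d.+1.
  by rewrite size_polyDl size_polyXn ?size_polyN ?ltnS.
have Pm : P \is monic.
  by rewrite monicE lead_coefDl ?lead_coefXn ?size_polyXn ?size_polyN ?ltnS.
have sQ : size Q = d.+2.
  by rewrite size_polyDl size_polyXn ?size_polyN ?ltnS ?leqW.
have Qm : Q \is monic.
  by rewrite monicE lead_coefDl ?lead_coefXn ?size_polyXn ?size_polyN ?ltnS ?leqW.
have [Q0|Q0] := boolP (root Q 0); last by exists Q.
have [P0|P0] := boolP (root P 0); last first.
  exists (Q + P); split.
  - by rewrite monicE lead_coefDl ?(monicP Qm) ?sP ?sQ.
  - by rewrite size_polyDl ?sP ?sQ.
  - by rewrite /root hornerD (rootP Q0) add0r.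
  - by move=> h sh; rewrite mulrDl linearD /= gorth ?g'orth ?addr0.
exfalso.
have [u Pu] : exists u, P = u * 'X.
  by have /factor_theorem := P0; rewrite subr0.
have [v Qv] : exists v, Q = v * 'X.
  by have /factor_theorem := Q0; rewrite subr0.
have v0 : v != 0.
  by apply: contra_eq_neq sQ => v0; rewrite Qv v0 mul0r size_poly0.
have u0 : u != 0.
  by apply: contra_eq_neq sP => u0; rewrite Pu u0 mul0r size_poly0.
have su : size u = d by move: sP; rewrite Pu size_mulX // => -[].
have sv : size v = d.+1 by move: sQ; rewrite Qv size_mulX // => -[].
have vm : v \is monic by have := Qm; rewrite Qv monicMr ?monicX.
have : L (P * v) = 0.
  by rewrite Pu mulrAC [u * v]mulrC mulrAC -Qv g'orth ?su.
have -> : P * v = P ^+ 2 + P * (v - P) by rewrite mulrBr expr2 subrKC.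
rewrite linearD /= [L (P * (v - P))]gorth ?addr0.
  by move=> /eqP; rewrite gt_eqF // Lpos ?monic_neq0 // sP.
by rewrite size_monicB ?sv ?sP.
Qed.

(** When [L] is positive definite its moment of order [2d + 1] is free; it is chosen
so as to make an orthogonal polynomial of degree [d + 1] that does not vanish
at 0 orthogonal to ['X^d] as well. Otherwise an isotropic [f] of least degree
serves: if [f = 'X * g], the last hypothesis makes [g] isotropic, of smaller
degree. *)
Lemma truncated_moments_atomic (R : rcfType) (L : {scalar {poly R}}) d :
  (forall g : {poly R}, (size g <= d.+1)%N -> 0 <= L (g ^+ 2)) ->
  (forall g h : {poly R}, (size g <= d.+1)%N -> L (g ^+ 2) = 0 ->
    (size (g * h)%R <= d.*2.+1)%N -> L (g * h) = 0) ->
  (forall g : {poly R}, (size g <= d)%N -> L (('X * g) ^+ 2) = 0 ->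
    L (g ^+ 2) = 0) ->
  exists (xs : seq R) (w : R -> R),
    [/\ 0 \notin xs, (forall x, x \in xs -> 0 <= w x) &
      forall g : {poly R}, (size g <= d.*2.+1)%N ->
        L g = \sum_(x <- xs) w x * g.[x]].
Proof.
move=> Lge0 Lker Lshift.
have [Lpos|[f [r [fm sf rd Lf Lr]]]] := posdef_or_kernel Lge0.
  have [f [fm sf f0 forth]] := orthogonal_nonroot Lpos.
  (* The coefficient of order [2d + 1] of [f * 'X^d] is 1, as [f] is monic of
     degree [d + 1], so this correction gives [L' (f * 'X^d) = 0]. *)
  have [L' L'E] := scalar_shift_coef L (- L (f * 'X^d)) d.*2.+1.
  have LL' (g : {poly R}) : (size g <= d.*2.+1)%N -> L' g = L g.
    by move=> sg; rewrite L'E nth_default // mulr0 addr0.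
  have L'pos : posdef L' d.+1.
    move=> g g0 sg; rewrite LL' ?Lpos //.
    rewrite expr2 (leq_trans (size_polyMleq _ _)) //; lia.
  have L'f (h : {poly R}) : (size h <= d.+1)%N -> L' (f * h) = 0.
    move=> sh; rewrite scalar_mul_poly big1 // => j _.
    have sfX : size (f * 'X^j) = (j + d.+2)%N.
      by rewrite size_monicM ?monic_neq0 ?monicXn // sf size_polyXn; lia.
    have [jd|] := ltnP j d.
      by rewrite LL' ?sfX ?forth ?mulr0 ?size_polyXn //; lia.
    move=> dj; have {dj sfX}-> : j = d :> nat.
      by apply/eqP; rewrite eqn_leq dj andbT -ltnS (leq_trans (ltn_ord j)).
    rewrite L'E coefMXn ltnNge; case: leqP => [_|]; last by lia.
    have -> : (d.*2.+1 - d = d.+1)%N by lia.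
    have -> : f`_d.+1 = 1 by rewrite -(monicP fm) lead_coefE sf.
    by rewrite mulr1 subrr mulr0.
  have [xs [w [xsf w0 L'w]]] := Gauss_quadrature L'pos fm sf L'f.
  exists xs, w; split=> //.
    by apply/negP => /(allP xsf); rewrite (negPf f0).
  by move=> g sg; rewrite -LL' // L'w //; lia.
have forth (h : {poly R}) : (size h <= r)%N -> L (f * h) = 0.
  move=> sh; apply: Lker => //; first by rewrite sf.
  by rewrite (leq_trans (size_polyMleq _ _)) // sf; lia.
have [xs [w [xsf w0 Lw]]] := Gauss_quadrature Lr fm sf forth.
exists xs, w; split=> //.
  apply/negP => /(allP xsf) /factor_theorem[g]; rewrite subr0 => fg.
  have g0 : g != 0 by apply: contra_eq_neq sf => g0; rewrite fg g0 mul0r size_poly0.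
  have sg : size g = r by move: sf; rewrite fg size_mulX // => -[].
  have : L (g ^+ 2) = 0 by apply: Lshift; rewrite ?sg // mulrC -fg.
  by move/eqP; rewrite gt_eqF // Lr ?sg.
move=> g sg; rewrite [g in LHS](divp_eq g f) linearD /= mulrC.
rewrite Lker ?sf // ?add0r; last first.
  have [sgf|sfg] := ltnP (size g) (size f).
    by rewrite divp_small // mulr0 size_poly0.
  rewrite (leq_trans (size_polyMleq _ _)) // size_divp ?monic_neq0 // sf /=.
  by rewrite subnKC // ltnW // -sf.
have sm : (size (g %% f)%R <= r)%N by rewrite -ltnS -sf ltn_modp monic_neq0.
rewrite Lw; last by rewrite (leq_trans sm) // -addnn leq_addl.
rewrite big_seq [RHS]big_seq; apply: eq_bigr => x /(allP xsf) /rootP fx.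
by rewrite [g in RHS](divp_eq g f) hornerD hornerM fx mulr0 add0r.
Qed.

(** Cauchy-Schwarz for a semidefinite form: if [L (g * h)] were nonzero, the square
of [h + t *: g] would have negative value for a suitable [t]. *)
Lemma isotropic_orthogonal (R : rcfType) (L : {scalar {poly R}}) m
    (g h : {poly R}) :
  (forall p : {poly R}, (size p <= m)%N -> 0 <= L (p ^+ 2)) ->
  (size g <= m)%N -> (size h <= m)%N -> L (g ^+ 2) = 0 -> L (g * h) = 0.
Proof.
move=> Lge0 sg sh Lg; apply/eqP; apply: contraT => Lgh.
(* With this [t] the square of [h + t *: g] has value -1. *)
pose t := - (L (h ^+ 2) + 1) / (2 * L (g * h)).
have : 0 <= L ((h + t *: g) ^+ 2).
  apply: Lge0; rewrite (leq_trans (size_polyD _ _)) // geq_max sh.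
  by rewrite (leq_trans (size_scale_leq _ _)).
have -> : (h + t *: g) ^+ 2 = h ^+ 2 + (2 * t) *: (g * h) + (t ^+ 2) *: (g ^+ 2).
  by rewrite -!mul_polyC !rmorphM /=; ring.
rewrite !linearD !linearZ /= Lg mulr0 addr0.
have -> : 2 * t * L (g * h) = - (L (h ^+ 2) + 1) by rewrite /t; field.
lra.
Qed.

(** Positivity is available one degree higher and one degree lower than for the
functional [g |-> L ('X^2 * g)] that is to be represented. If [g] is isotropic
for the latter, then ['X * g] is isotropic for [L], and so are all ['X^j * g]
with [j > 0] of degree less than [d + 2], because
[('X^j.+1 * g) ^ 2 = ('X^j * g) * ('X^j.+2 * g)]. Products with these reach all
degrees that are needed. Likewise
[L (('X * g) ^ 2) = L (('X * ('X * g)) * g)] is 0 as soon as ['X^2 * g] is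
isotropic for [L]. *)
Lemma extended_moments_atomic (R : rcfType) (L : {scalar {poly R}}) d :
  (forall g : {poly R}, (size g <= d.+3)%N -> 0 <= L (g ^+ 2)) ->
  exists (xs : seq R) (w : R -> R),
    [/\ 0 \notin xs, (forall x, x \in xs -> 0 <= w x) &
      forall g : {poly R}, (size g <= d.*2.+1)%N ->
        L ('X^2 * g) = \sum_(x <- xs) w x * g.[x]].
Proof.
move=> Lge0.
have lin : scalar (fun g : {poly R} => L ('X^2 * g)).
  by move=> a g h; rewrite mulrDr -scalerAr linearP.
pose lin' := GRing.isLinear.Build R {poly R} R *%R _ lin.
pose L' : {scalar {poly R}} := HB.pack (fun g : {poly R} => L ('X^2 * g)) lin'.
have L'E g : L' g = L ('X^2 * g) by [].
have L'sq g : L' (g ^+ 2) = L (('X * g) ^+ 2) by rewrite L'E exprMn.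
have sXn (g : {poly R}) j : (size ('X^j * g)%R <= j + size g)%N.
  by rewrite (leq_trans (size_polyMleq _ _)) // size_polyXn.
apply: (@truncated_moments_atomic _ L').
- move=> g sg; rewrite L'sq Lge0 // (leq_trans (sXn g 1)) //.
  by rewrite add1n ltnS leqW.
- move=> g h sg; rewrite L'sq L'E => Lg sgh.
  have [g0|g0] := eqVneq g 0; first by rewrite g0 mul0r mulr0 linear0.
  have [h0|h0] := eqVneq h 0; first by rewrite h0 !mulr0 linear0.
  have LX j : (j + size g < d.+2)%N -> L (('X^(j.+1) * g) ^+ 2) = 0.
    elim: j => [|j IH] sj; first by rewrite expr1.
    have -> : ('X^(j.+2) * g) ^+ 2 = ('X^(j.+1) * g) * ('X^(j.+3) * g).
      by rewrite !exprS; ring.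
    have := sXn g j.+1; have := sXn g j.+3 => s1 s2.
    by apply: (isotropic_orthogonal Lge0); rewrite ?IH //; lia.
  rewrite mulrA scalar_mul_poly big1 // => k _.
  have km : (k + size g <= d.*2.+1)%N.
    move: sgh (ltn_ord k); rewrite size_mul //.
    move: g0; rewrite -size_poly_gt0.
    by set a := size g; set b := size h; lia.
  (* The product ['X^(2 + k) * g] is cut into the isotropic ['X^(j + 1) * g],
     with [j] as large as the degree bound permits, and ['X^i]. *)
  pose j := minn k (d.+1 - size g); pose i := (k.+1 - j)%N.
  have ji : (j.+1 + i = k + 2)%N by rewrite /i /j; lia.
  have -> : 'X^2 * g * 'X^k = ('X^(j.+1) * g) * 'X^i.
    by rewrite mulrAC -exprD [in RHS]mulrAC -exprD ji addnC.
  rewrite (isotropic_orthogonal Lge0) ?mulr0 ?LX // /j /i ?size_polyXn; try lia.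
  have := sXn g j.+1; rewrite /j; lia.
- move=> g sg; rewrite !L'sq => Lg.
  have -> : ('X * g) ^+ 2 = ('X * ('X * g)) * g by ring.
  apply: (isotropic_orthogonal Lge0) Lg; last by rewrite !leqW.
  by rewrite mulrA -expr2 (leq_trans (sXn _ _)) // !ltnS leqW.
Qed.

(** * Bivariate monomials, the Riesz functional and its Gram matrices *)

Definition xy (R : realType) (i j : nat) : poly2 R := varx R ^+ i * vary R ^+ j.

Lemma mpolyX_xy (R : realType) (m : multinom 2) :
  mpolyX R m = xy R (m ord0) (m ord_max).
Proof.
rewrite mpolyXE_id big_ord_recl big_ord_recl big_ord0 mulr1 /xy /varx /vary.
by congr (_ * mpolyX R (mnm1 _) ^+ m _); apply: val_inj.
Qed.

Lemma xyM (R : realType) i j i' j' : xy R i j * xy R i' j' = xy R (i + i') (j + j').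
Proof. by rewrite /xy !exprD; ring. Qed.

Definition mnm_xy i j : multinom 2 :=
  mnm_add (mnm_muln (mnm1 (ord0 : 'I_2)) i) (mnm_muln (mnm1 (ord_max : 'I_2)) j).

Lemma mdeg_mnm_xy i j : mdeg (mnm_xy i j) = (i + j)%N.
Proof. by rewrite mdegD !mdegMn !mdeg1 !mul1n. Qed.

Lemma xyE (R : realType) i j : xy R i j = mpolyX R (mnm_xy i j).
Proof. by rewrite mpolyXD -!mpolyXn. Qed.

Lemma mdeg_xy (m : multinom 2) : mdeg m = (m ord0 + m ord_max)%N.
Proof.
rewrite mdegE big_ord_recl big_ord_recl big_ord0 addn0.
by congr (_ + m _)%N; apply: val_inj.
Qed.

Lemma msize_xy (R : realType) i j : msize (xy R i j) = (i + j).+1.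
Proof. by rewrite xyE msizeX mdeg_mnm_xy. Qed.

Lemma eval2_xy (R : realType) i j (z : R * R) :
  eval2 (xy R i j) z = z.1 ^+ i * z.2 ^+ j.
Proof. by rewrite /eval2 rmorphM !rmorphXn /= !mevalXU. Qed.

Lemma riesz_is_scalar (R : realType) n (b : tseq R n) : scalar (riesz b).
Proof.
move=> a p q; rewrite /riesz mulr_sumr -big_split; apply: eq_bigr => m _ /=.
by rewrite mcoeffD mcoeffZ; ring.
Qed.

HB.instance Definition _ (R : realType) n (b : tseq R n) :=
  GRing.isLinear.Build R (poly2 R) R *%R (riesz b) (riesz_is_scalar b).

Lemma riesz_mon (R : realType) n (b : tseq R n) (m : mon (2 * n)) :
  riesz b (mon_poly R m) = b m.
Proof.
rewrite /riesz (bigD1 m) //= /mon_poly mcoeffX eqxx mul1r big1 ?addr0 // => k km.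
by rewrite mcoeffX eq_sym -bmeqP (negPf km) mul0r.
Qed.

Lemma riesz_xyE (R : realType) n (b : tseq R n) (m : mon (2 * n)) :
  b m = riesz b (xy R (m ord0) (m ord_max)).
Proof. by rewrite -riesz_mon /mon_poly mpolyX_xy. Qed.

Lemma mon_xyP k i j : (i + j <= k)%N ->
  exists m : mon k, m ord0 = i /\ m ord_max = j.
Proof.
move=> ijk; have mk : (mdeg (mnm_xy i j) < k.+1)%N by rewrite mdeg_mnm_xy.
by exists (BMultinom mk); rewrite /= !mnmDE !mulmnE !mnm1E /= !mul1n !mul0n addn0.
Qed.

(** With [q = 1] this is the moment matrix; with [k] depending on the degree of [q]
it is the localizing matrix. The size is a separate argument because the
localizing matrices of [p] and [- p] have sizes that are only provably equal. *)
Definition gram (R : realType) n (b : tseq R n) (q : poly2 R) k :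
    'M[R]_(#|{: mon k}|) :=
  \matrix_(i, j) riesz b (q * mon_poly R (enum_val i) * mon_poly R (enum_val j)).

Lemma moment_gram (R : realType) n (b : tseq R n) : moment_mx b = gram b 1 n.
Proof. by apply/matrixP => i j; rewrite !mxE mul1r. Qed.

(** The quadratic form of the matrix at the coefficient vector of [u] is
[L (q * u ^ 2)], and coefficient vectors range over all polynomials of degree at
most [k]. *)
Lemma psd_gramP (R : realType) n (b : tseq R n) (q : poly2 R) k :
  psd (gram b q k) <->
  forall u : poly2 R, (msize u <= k.+1)%N -> 0 <= riesz b (q * u * u).
Proof.
have form (v : 'rV_#|{: mon k}|) :
    (v *m gram b q k *m v^T) ord0 ord0 =
    riesz b (q * (\sum_i v ord0 i *: mon_poly R (enum_val i))
               * (\sum_i v ord0 i *: mon_poly R (enum_val i))).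
  rewrite mxE mulr_sumr linear_sum /=; apply: eq_bigr => j _.
  rewrite mxE mulr_sumr !mulr_suml linear_sum /=; apply: eq_bigr => i _.
  rewrite !mxE; rewrite -[in RHS]scalerAr [in RHS]linearZ -[in RHS]scalerAr -[in RHS]scalerAl [in RHS]linearZ /=; ring.
split=> [[_ pos] u uk|pos]; last first.
  split; first by apply/matrixP => i j; rewrite !mxE mulrAC.
  move=> v; rewrite form; apply: pos.
  rewrite (leq_trans (mmeasure_sum _ _ _ _)) //; apply/bigmax_leqP => i _.
  by rewrite (leq_trans (msizeZ_le _ _)) // msizeX bmdeg.
have uE : u = \sum_(i < #|{: mon k}|)
    mcoeff (enum_val i : mon k) u *: mon_poly R (enum_val i : mon k).
  rewrite {1}(mpolywE uk).
  by rewrite (reindex (@enum_val _ {: mon k})) //; apply: onW_bij; apply: enum_val_bij.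
have := pos (\row_i mcoeff (enum_val i : mon k) u); rewrite form.
by under eq_bigr do rewrite mxE; rewrite -uE.
Qed.

(** * Finitely atomic sequences and their extensions *)

(** An atom is a pair of a weight and a point. *)
Definition atomic_on (R : realType) (p : poly2 R) n (b : tseq R n)
    (s : seq (R * (R * R))) :=
  (forall a, a \in s -> 0 <= a.1 /\ eval2 p a.2 = 0) /\
  forall m : mon (2 * n), b m = \sum_(a <- s) a.1 * eval2 (mon_poly R m) a.2.

Lemma riesz_atomic (R : realType) (p : poly2 R) n (b : tseq R n) s (q : poly2 R) :
  atomic_on p b s -> (msize q <= (2 * n).+1)%N ->
  riesz b q = \sum_(a <- s) a.1 * eval2 q a.2.
Proof.
move=> [_ bs] sq; rewrite [in RHS](mpolywE sq).
under [RHS]eq_bigr do rewrite /eval2 raddf_sum mulr_sumr.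
rewrite exchange_big; apply: eq_bigr => m _ /=; rewrite bs mulr_sumr.
by apply: eq_bigr => a _; rewrite mevalZ /eval2 /mon_poly; ring.
Qed.

Lemma psd_gram_atomic (R : realType) (p : poly2 R) n (b : tseq R n) s
    (q : poly2 R) k :
  atomic_on p b s -> (deg2 q + 2 * k <= 2 * n)%N ->
  (forall z, eval2 p z = 0 -> 0 <= eval2 q z) -> psd (gram b q k).
Proof.
move=> bs qk q0; apply/psd_gramP => u uk.
have pos : {in s, forall a, 0 <= a.1 * eval2 (q * u * u) a.2}.
  move=> a /(proj1 bs)[a0 pa]; rewrite mulr_ge0 // /eval2 -mulrA !rmorphM /=.
  by rewrite mulr_ge0 ?q0 // -expr2 sqr_ge0.
rewrite (riesz_atomic bs); first by rewrite big_seq sumr_ge0.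
have [->|q0'] := eqVneq q 0; first by rewrite !mul0r mmeasure0.
have [->|u0] := eqVneq u 0; first by rewrite mulr0 mmeasure0.
rewrite !msizeM ?mulf_neq0 //; move: qk uk; rewrite /deg2.
by move: (mmeasure _ q) (mmeasure _ u) => x y; lia.
Qed.

(** The extension consists of the moments of higher order of the same atoms; on
them [p] is 0, so both localizing forms vanish. *)
Lemma atomic_property (R : realType) (p : poly2 R) n k (b : tseq R n) s :
  atomic_on p b s -> (deg2 p <= 2 * (n + k))%N ->
  exists b' : tseq R (n + k), positive_extension b b' /\
    forall i, (0 < i < 3)%N ->
      psd (localizing_mx b' [:: 1; p; - p]`_i).
Proof.
move=> bs pk.
pose b' : tseq R (n + k) := fun m => \sum_(a <- s) a.1 * eval2 (mon_poly R m) a.2.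
have b's : atomic_on p b' s by split=> // a /(proj1 bs).
have deg1 : deg2 (1 : poly2 R) = 0%N by rewrite /deg2 msize1.
have uphalfE (d m : nat) : (d <= 2 * m -> d + 2 * (m - uphalf d) <= 2 * m)%N.
  by have := uphalf_half d; have := odd_double_half d; lia.
have degN : deg2 (- p) = deg2 p by rewrite /deg2 mmeasureN.
exists b'; split; [split|].
- rewrite moment_gram.
  by apply: (psd_gram_atomic b's); rewrite ?deg1 // /eval2 => z _; rewrite meval1.
- apply/matrixP => i j; rewrite !mxE !enum_rankK.
  have ijn m : (n <= m)%N -> (msize (mon_poly R (enum_val i : mon n) *
      mon_poly R (enum_val j : mon n))%R <= (2 * m).+1)%N.
    move=> nm; rewrite -mpolyXD msizeX mdegD ltnS.
    by rewrite (leq_trans _ (leq_mul (leqnn 2) nm)) // mul2n -addnn leq_add // -ltnS bmdeg.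
  by rewrite (riesz_atomic b's) ?(riesz_atomic bs) ?ijn ?leq_addr.
- case=> [|[|[|i]]] // _.
    by apply: (psd_gram_atomic b's); rewrite ?uphalfE // => z ->.
  apply: (psd_gram_atomic b's); first by rewrite uphalfE // degN.
  by move=> z pz; rewrite /eval2 mevalN -/(eval2 p z) pz oppr0.
Qed.

(** * Transfer from the line to the curve *)

(** A node [x] on the line becomes the point [(x ^ l2, x ^ (- l1))] of the curve.
The factor [x ^ (2 * n * l1)] that made the Laurent monomials polynomial is
moved into the weight, which stays nonnegative as the exponent is even. *)
Lemma atomic_of_line (R : realType) l1 l2 n (b : tseq R n) (xs : seq R) (w : R -> R) :
  0 \notin xs -> (forall x, x \in xs -> 0 <= w x) ->
  (forall i j, (i + j <= 2 * n)%N -> riesz b (xy R i j) =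
    \sum_(x <- xs) w x * x ^+ (l2 * i + l1 * (2 * n - j))) ->
  exists s, atomic_on (xy R l1 l2 - 1) b s.
Proof.
move=> xs0 w0 bxs.
exists [seq (w x * x ^+ (2 * n * l1), (x ^+ l2, (x ^+ l1)^-1)) | x <- xs]; split.
  move=> _ /mapP[x xin ->] /=; split.
    by rewrite mulr_ge0 ?w0 // -mulnA exprM exprn_ge0 // sqr_ge0.
  have x0 : x != 0 by apply: contraNneq xs0 => <-.
  rewrite /eval2 mevalB meval1 -/(eval2 _ _) eval2_xy /= -exprM exprVn -exprM.
  by rewrite mulnC mulfV ?expf_neq0 // subrr.
move=> m; rewrite riesz_xyE big_map /=.
have mn : (m ord0 + m ord_max <= 2 * n)%N by rewrite -mdeg_xy -ltnS bmdeg.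
move: (m ord0) (m ord_max) mn (mpolyX_xy R m) => i j ij mE.
rewrite bxs // big_seq [RHS]big_seq; apply: eq_bigr => x xin.
have x0 : x != 0 by apply: contraNneq xs0 => <-.
rewrite /mon_poly mE eval2_xy /= exprD exprVn -!exprM.
have -> : (2 * n * l1 = l1 * (2 * n - j) + l1 * j)%N.
  by rewrite -mulnDr subnK; [ring|lia].
rewrite exprD; have := expf_neq0 (l1 * j) x0.
by move: (x ^+ (l1 * j)) => y y0; field.
Qed.

Lemma line_exponent_le l1 l2 n i j : (i + j <= 2 * n)%N ->
  (l2 * i + l1 * (2 * n - j) <= (n * (l1 + l2)).*2)%N.
Proof.
move=> ij; have il : (i <= 2 * n)%N by lia.
have := leq_mul (leqnn l2) il; have := leq_mul (leqnn l1) (leq_subr j (2 * n)).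
rewrite mulnDr; lia.
Qed.

(** The Bezout relation [u * l2 = v * l1 + 1] turns the parameter into a monomial,
so it is defined and measurable on the whole plane. *)
Lemma curve_parameter (R : realType) l1 l2 : coprime l1 l2 -> (0 < l1)%N ->
  (0 < l2)%N ->
  exists u v, forall x y : R, x ^+ l1 * y ^+ l2 = 1 ->
    x = (x ^+ u * y ^+ v) ^+ l2 /\ y * (x ^+ u * y ^+ v) ^+ l1 = 1.
Proof.
move=> co l1p l2p.
(* This yields [u * l2 = v * l1 + gcd], with natural coefficients. *)
have [u v uv _] := egcdnP l1 l2p.
have {}uv : (u * l2 = v * l1 + 1)%N.
  by rewrite uv; congr (_ + _)%N; apply/eqP; rewrite -[_ == _]/(coprime l2 l1) coprime_sym.
exists u, v => x y xy1.
have xE : (x ^+ u * y ^+ v) ^+ l2 = x.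
  rewrite exprMn -!exprM uv exprD expr1 mulrAC mulnC exprM.
  by rewrite [(v * l2)%N]mulnC exprM -exprMn xy1 expr1n mul1r.
split; first by rewrite xE.
rewrite exprMn -!exprM mulrCA -exprS -[(v * l1).+1]addn1 -uv.
by rewrite mulnC exprM [(u * l2)%N]mulnC exprM -exprMn xy1 expr1n.
Qed.

(** The two extreme Laurent exponents, those of [x ^ (2n)] and [y ^ (2n)], dominate
all exponents in between: the first for [|t| >= 1], the second for [|t| <= 1]. *)
Lemma curve_monomial_bound (R : realType) l1 l2 n k (x y t : R) :
  (k <= 2 * (n * (l1 + l2)))%N -> x = t ^+ l2 -> y * t ^+ l1 = 1 ->
  `|y ^+ (2 * n) * t ^+ k| <= x ^+ (2 * n) + y ^+ (2 * n).
Proof.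
move=> kd xE yt.
have sq (z : R) : 0 <= z ^+ (2 * n) by rewrite exprM exprn_ge0 // sqr_ge0.
rewrite normrM (ger0_norm (sq y)) normrX.
have [t1|t1] := leP `|t| 1.
  rewrite (le_trans (ler_piMr (sq y) (exprn_ile1 _ _ t1))) // ?normr_ge0 //.
  by rewrite lerDr sq.
apply: (@le_trans _ _ (x ^+ (2 * n))); last by rewrite lerDl sq.
have -> : x ^+ (2 * n) = y ^+ (2 * n) * `|t| ^+ (2 * (n * (l1 + l2))).
  rewrite -normrX ger0_norm; last by rewrite exprM exprn_ge0 // sqr_ge0.
  have -> : (2 * (n * (l1 + l2)) = l1 * (2 * n) + l2 * (2 * n))%N by ring.
  rewrite exprD mulrA [t ^+ (l1 * _)]exprM -exprMn yt expr1n mul1r.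
  by rewrite [in RHS]exprM -xE.
by rewrite ler_wpM2l ?sq // ler_weXn2l // ltW.
Qed.

Lemma curve_monomial (R : realType) l1 l2 n i j (x y t : R) :
  (i + j <= 2 * n)%N -> x = t ^+ l2 -> y * t ^+ l1 = 1 ->
  y ^+ (2 * n) * t ^+ (l2 * i + l1 * (2 * n - j)) = x ^+ i * y ^+ j.
Proof.
move=> ij xE yt; have -> : y ^+ (2 * n) = y ^+ (2 * n - j) * y ^+ j.
  by rewrite -exprD subnK //; lia.
rewrite exprD [t ^+ (l1 * _)]exprM [t ^+ (l2 * _)]exprM -xE.
rewrite -[RHS]mul1r -(expr1n _ (2 * n - j)) -yt exprMn.
by ring.
Qed.

(** The degree of the defining polynomial fixes the sizes of its localizing
matrices. *)
Lemma curve_deg2 (R : realType) l1 l2 : (0 < l1 + l2)%N ->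
  deg2 (xy R l1 l2 - 1) = (l1 + l2)%N.
Proof.
move=> l0; rewrite /deg2; suff -> : msize (xy R l1 l2 - 1) = (l1 + l2).+1 by [].
apply/eqP; rewrite eqn_leq (leq_trans (mmeasureD_le _ _ _)) /=; last first.
  by rewrite mmeasureN msize1 geq_max msize_xy ltnSn.
rewrite -(mdeg_mnm_xy l1 l2) msize_mdeg_lt // mcoeff_msupp mcoeffB xyE mcoeffX eqxx.
have -> : (1 : poly2 R) = mpolyX R (@mnm0 2) by rewrite mpolyX0.
rewrite mcoeffX; have [e|_] := eqVneq (@mnm0 2) (mnm_xy l1 l2); last by rewrite subr0 oner_neq0.
by move: l0; rewrite -(mdeg_mnm_xy l1 l2) -e mdeg0.
Qed.

(** * From a positive extension to atoms *)

(** Both forms being nonnegative, the quadratic form of [p] is identically 0, and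
polarization makes the bilinear form vanish too. *)
Lemma localizing_psd_eq0 (R : realType) n (b : tseq R n) (p : poly2 R) k (u v : poly2 R) :
  psd (gram b p k) -> psd (gram b (- p) k) ->
  (msize u <= k.+1)%N -> (msize v <= k.+1)%N -> riesz b (p * u * v) = 0.
Proof.
move=> /psd_gramP pos /psd_gramP neg.
have sq w : (msize w <= k.+1)%N -> riesz b (p * w * w) = 0.
  move=> wk; apply/eqP; rewrite eq_le pos // andbT -oppr_ge0 -linearN /=.
  by rewrite -!mulNr neg.
move=> uk vk; have := sq (u + v).
have -> : p * (u + v) * (u + v) = p * u * u + p * v * v + (p * u * v + p * u * v).
  by ring.
rewrite !linearD /= !sq // !add0r => uv.
apply/eqP; rewrite -[_ == 0](mulrn_eq0 _ 2) mulr2n uv //.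
by rewrite (leq_trans (mmeasureD_le _ _ _)) // geq_max uk.
Qed.

(** A monomial of degree at most [2k] is a product of two of degree at most [k], so
that its moment is an entry of a Gram matrix. *)
Lemma xy_split i j k : (i + j <= 2 * k)%N -> exists i1 j1 i2 j2,
  [/\ i = (i1 + i2)%N, j = (j1 + j2)%N, (i1 + j1 <= k)%N & (i2 + j2 <= k)%N].
Proof.
move=> ij; pose i1 := minn i k; pose j1 := minn j (k - i1).
by exists i1, j1, (i - i1)%N, (j - j1)%N; rewrite /j1 /i1; split; lia.
Qed.

Lemma positive_extension_riesz (R : realType) n k (b : tseq R n)
    (b' : tseq R (n + k)) i j :
  positive_extension b b' -> (i + j <= 2 * n)%N ->
  riesz b' (xy R i j) = riesz b (xy R i j).
Proof.
move=> [_ bb'] /xy_split[i1 [j1 [i2 [j2 [-> -> /mon_xyP[u [<- <-]] /mon_xyP[v [<- <-]]]]]]].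
have /matrixP/(_ (enum_rank u) (enum_rank v)) := bb'.
by rewrite !mxE !enum_rankK -!xyM /mon_poly !mpolyX_xy.
Qed.

(** Two pairs with the same value of [l2 * i - l1 * j] differ by a multiple of
[(l1, l2)], by coprimality; the invariance is then applied step by step, and all
intermediate pairs have smaller degree. *)
Lemma coprime_shift_invariant (T : Type) l1 l2 m (F : nat -> nat -> T) :
  coprime l1 l2 -> (0 < l1)%N -> (0 < l2)%N ->
  (forall i j, (i + l1 + (j + l2) <= m)%N -> F (i + l1)%N (j + l2)%N = F i j) ->
  forall i j i' j', (i + j <= m)%N -> (i' + j' <= m)%N ->
    (l2 * i + l1 * j' = l2 * i' + l1 * j)%N -> F i j = F i' j'.
Proof.
move=> co l1pos l2pos Fshift.
have Fmul a i j : (i + a * l1 + (j + a * l2) <= m)%N ->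
    F (i + a * l1)%N (j + a * l2)%N = F i j.
  elim: a => [|a IH] am; first by rewrite !mul0n !addn0.
  rewrite -IH; last by lia.
  have -> : (i + a.+1 * l1 = i + a * l1 + l1)%N by lia.
  have -> : (j + a.+1 * l2 = j + a * l2 + l2)%N by lia.
  by apply: Fshift; lia.
have main i j i' j' : (i' <= i)%N -> (i + j <= m)%N -> (i' + j' <= m)%N ->
    (l2 * i + l1 * j' = l2 * i' + l1 * j)%N -> F i j = F i' j'.
  move=> ii ij ij' e.
  have : (l1 %| l2 * (i - i'))%N.
    by apply/dvdnP; exists (j - j')%N; rewrite mulnBr mulnBl; lia.
  rewrite Gauss_dvdr // => /dvdnP[a ia].
  have iE : i = (i' + a * l1)%N by rewrite -ia subnKC.
  have jE : j = (j' + a * l2)%N.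
    apply/eqP; rewrite -(eqn_pmul2l l1pos) mulnDr; apply/eqP.
    have -> : (l1 * (a * l2) = l2 * (a * l1))%N by ring.
    by move: e; rewrite iE mulnDr; lia.
  by rewrite iE jE Fmul // -iE -jE.
move=> i j i' j' ij ij' e.
by case: (leqP i' i) => ii; [|apply/esym]; apply: main => //; lia.
Qed.

(** The equation means [k - (n * l1 + 1) = l2 * i - l1 * j], an equality of Laurent
exponents. If the exponent is nonnegative, take [j < l2] in the required residue
class modulo [l2]; then [i < n + l1] as [2 <= l1]. If it is negative, take
[i < l1]; then [j < n + l2] as [2 <= l2]. *)
Lemma exponent_pair l1 l2 n k : coprime l1 l2 -> (2 <= l1)%N -> (2 <= l2)%N ->
  (k <= n * (l1 + l2) + 2)%N ->
  exists i j, (l2 * i + n * l1 + 1 = l1 * j + k)%N /\ (i + j <= n + l1 + l2 - 2)%N.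
Proof.
move=> co l1ge l2ge kle.
have solve a b c : coprime a b -> (0 < b)%N ->
    exists2 x, (x < b)%N & (b %| a * x + c)%N.
  (* [y] is 0 modulo [a] and [- c] modulo [b]. *)
  move=> cab b0; pose y := chinese a b 0 (b - c %% b).
  have /dvdnP[t yt] : (a %| y)%N by rewrite /dvdn /y chinese_modl // mod0n.
  exists (t %% b)%N; first by rewrite ltn_mod.
  rewrite /dvdn -modnDml modnMmr mulnC -yt /y chinese_modr // modnDml -modnDmr.
  by rewrite subnK ?modnn // ltnW // ltn_mod.
have [ke|ke] := leqP (n * l1 + 1) k.
  have [j jl /dvdnP[i ij]] := solve l1 l2 (k - (n * l1 + 1))%N co (ltnW l2ge).
  exists i, j; split; first by lia.
  have : (i < n + l1)%N.
    rewrite -(ltn_pmul2r (ltnW l2ge)) -ij.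
    have : (l1 * j <= l1 * (l2 - 1))%N by rewrite leq_mul //; lia.
    rewrite mulnBr muln1 mulnDl; move: kle; rewrite mulnDr.
    by have := leq_pmulr l1 (ltnW l2ge); lia.
  lia.
have [i il /dvdnP[j ij]] := solve l2 l1 (n * l1 + 1 - k)%N
  (etrans (coprime_sym l2 l1) co) (ltnW l1ge).
exists i, j; split; first by lia.
have : (j < n + l2)%N.
  rewrite -(ltn_pmul2r (ltnW l1ge)) -ij.
  have : (l2 * i <= l2 * (l1 - 1))%N by rewrite leq_mul //; lia.
  rewrite mulnBr muln1 mulnDl.
  by have := leq_pmulr l2 (ltnW l1ge); lia.
lia.
Qed.

(** The localizing entry of [p] at two monomials with product [x ^ i * y ^ j] is
the difference of the two sides. The bound is [2 * n - 2] so that it also holds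
when the degree [l1 + l2] is odd and its half is rounded up. *)
Lemma curve_shift_invariant (R : realType) l1 l2 n (b : tseq R n) i j :
  let p := xy R l1 l2 - 1 in (0 < l1 + l2)%N ->
  psd (localizing_mx b p) -> psd (localizing_mx b (- p)) ->
  (i + l1 + (j + l2) <= 2 * n - 2)%N ->
  riesz b (xy R (i + l1) (j + l2)) = riesz b (xy R i j).
Proof.
move=> p l0; have degp : deg2 p = (l1 + l2)%N := curve_deg2 R l0.
have degNp : deg2 (- p) = (l1 + l2)%N by rewrite /deg2 mmeasureN.
rewrite -[localizing_mx b p]/(gram b p _) -[localizing_mx b (- p)]/(gram b (- p) _).
rewrite degp degNp => pos neg ijn.
have [|i1 [j1 [i2 [j2 [iE jE ij1 ij2]]]]] := @xy_split i j (n - uphalf (l1 + l2)).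
  by have := uphalf_half (l1 + l2); have := odd_double_half (l1 + l2); lia.
have := localizing_psd_eq0 (u := xy R i1 j1) (v := xy R i2 j2) pos neg.
rewrite !msize_xy !ltnS => /(_ ij1 ij2).
rewrite -mulrA xyM -iE -jE mulrBl mul1r xyM linearB /= => /eqP.
by rewrite subr_eq0 ![(_ + i)%N]addnC ![(_ + j)%N]addnC => /eqP.
Qed.

(** The functional [L] on the line sends ['X^k] to the moment of a monomial that
restricts to [t ^ (k - 2 * (n * l1 + 1))] on the curve; shift invariance makes
the choice of the monomial irrelevant. A square of a polynomial in [t] is then
the square of a bivariate polynomial, and positivity carries over. *)
Lemma extension_atomic (R : realType) l1 l2 n (b : tseq R n)
    (b' : tseq R (n + (l1 + l2 - 1))) :
  let p := xy R l1 l2 - 1 in (2 <= l1)%N -> (2 <= l2)%N -> coprime l1 l2 ->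
  positive_extension b b' ->
  psd (localizing_mx b' p) -> psd (localizing_mx b' (- p)) ->
  exists s, atomic_on p b s.
Proof.
move=> p l1ge l2ge co bb' pos neg.
pose N := (n + (l1 + l2 - 1))%N; pose d := (n * (l1 + l2))%N.
pose F i j := riesz b' (xy R i j).
have Fsame i j i' j' : (i + j <= 2 * N - 2)%N -> (i' + j' <= 2 * N - 2)%N ->
    (l2 * i + l1 * j' = l2 * i' + l1 * j)%N -> F i j = F i' j'.
  apply: (coprime_shift_invariant co); [lia|lia|].
  by move=> i0 j0; apply: curve_shift_invariant; rewrite ?addn_gt0 ?(ltnW l1ge).
have [e eP] : {e : nat -> nat * nat & forall k, (k <= d + 2)%N ->
    (l2 * (e k).1 + n * l1 + 1 = l1 * (e k).2 + k)%N /\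
    ((e k).1 + (e k).2 <= N - 1)%N}.
  apply: (@choice _ _ (fun k ij => (k <= d + 2)%N ->
    (l2 * ij.1 + n * l1 + 1 = l1 * ij.2 + k)%N /\ (ij.1 + ij.2 <= N - 1)%N)) => k.
  have [kd|kd] := leqP k (d + 2); last by exists (0, 0)%N => ?; lia.
  have [i [j [ij1 ij2]]] := exponent_pair co l1ge l2ge kd.
  by exists (i, j) => _ /=; split=> //; rewrite /N; lia.
pose V k := xy R (e k).1 (e k).2.
(* The exponent [k] is cut into two parts that are both at most [d + 2],
   the range in which [V] is defined. *)
pose s k := let i := minn k (d + 2) in riesz b' (V i * V (k - i)%N).
have sE i j : (i <= d + 2)%N -> (j <= d + 2)%N ->
    riesz b' (V i * V j) = s (i + j)%N.
  move=> id jd; rewrite /s /V !xyM; set k := minn _ _.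
  have [e1 e1'] := eP i id; have [e2 e2'] := eP j jd.
  have [e3 e3'] := eP k (geq_minr _ _).
  have [|e4 e4'] := eP (i + j - k)%N; first by rewrite /k; lia.
  apply: Fsame; [lia|lia|].
  by rewrite !mulnDr; move: e1 e2 e3 e4; rewrite /k; lia.
pose M := (2 * (d + 2)).+1.
have [L LX] := scalar_of_moments s M.
have Lge0 (g : {poly R}) : (size g <= d.+3)%N -> 0 <= L (g ^+ 2).
  move=> sg.
  have gd (i : 'I_(size g)) : (i <= d + 2)%N.
    by rewrite -ltnS addn2 (leq_trans (ltn_ord i)).
  pose U := \sum_(i < size g) g`_i *: V i.
  have -> : L (g ^+ 2) = riesz b' (1 * U * U).
    rewrite mul1r expr2 scalar_mul_poly mulr_sumr linear_sum /=; apply: eq_bigr => j _.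
    rewrite mulrC [g * _]mulrC scalar_mul_poly mulr_suml mulr_suml linear_sum /=.
    apply: eq_bigr => i _; have ig := gd i; have jg := gd j.
    rewrite -exprD LX; last by rewrite ltnS mul2n -addnn leq_add.
    rewrite -[in RHS]scalerAr [in RHS]linearZ -[in RHS]scalerAl [in RHS]linearZ /=.
    by rewrite sE // [(j + i)%N]addnC; ring.
  have [psdM _] := bb'.
  have /psd_gramP : psd (gram b' 1 N) by rewrite -moment_gram.
  apply; rewrite (leq_trans (mmeasure_sum _ _ _ _)) //; apply/bigmax_leqP => i _.
  rewrite (leq_trans (msizeZ_le _ _)) // msize_xy ltnS.
  have [|_ ei] := eP i; first exact: gd.
  by rewrite (leq_trans ei) // leq_subr.
have [xs [w [xs0 w0 Lxs]]] := extended_moments_atomic Lge0.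
apply: (atomic_of_line xs0 w0) => i j ij; set k := (l2 * i + _)%N.
have kd : (k <= d.*2)%N := line_exponent_le l1 l2 ij.
have -> : riesz b (xy R i j) = L ('X^2 * 'X^k).
  rewrite -(positive_extension_riesz bb' ij) -exprD LX; last by rewrite /M; lia.
  rewrite /s /V xyM; set q := minn _ _.
  have [e3 e3'] := eP q (geq_minr _ _).
  have [|e4 e4'] := eP (2 + k - q)%N; first by rewrite /q; lia.
  apply: Fsame; [rewrite /N; lia|lia|].
  have : (l1 * (2 * n - j) + l1 * j = 2 * (n * l1))%N.
    by rewrite -mulnDr subnK; [ring|lia].
  by rewrite !mulnDr; move: e3 e4; rewrite /k /q; lia.
rewrite Lxs ?size_polyXn //; apply: eq_bigr => x _.
by rewrite hornerXn.
Qed.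

(** * From atoms to a measure *)

Section Measures.

Local Open Scope classical_set_scope.

Lemma measurable_borel2 (R : realType) (f : R * R -> R) :
  continuous f -> measurable_fun [set: borel2 R] (f : borel2 R -> R).
Proof.
move=> /continuousP cf; apply: (measurability _ (RGenOpens.measurableE R)).
move=> _ [_ [a [b ->] <-]]; rewrite setTI; apply: sub_sigma_algebra.
exact/cf/interval_open.
Qed.

Lemma measurable_coord1 (R : realType) :
  measurable_fun [set: borel2 R] (fun z : borel2 R => z.1 : R).
Proof. by apply: measurable_borel2 => z; exact: cvg_fst. Qed.

Lemma measurable_coord2 (R : realType) :
  measurable_fun [set: borel2 R] (fun z : borel2 R => z.2 : R).
Proof. by apply: measurable_borel2 => z; exact: cvg_snd. Qed.

Lemma measurable_mon (R : realType) i j :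
  measurable_fun [set: borel2 R] (fun z : borel2 R => z.1 ^+ i * z.2 ^+ j : R).
Proof.
apply: measurable_funM; apply: measurable_funX.
  exact: measurable_coord1.
exact: measurable_coord2.
Qed.

Lemma eval2_mon (R : realType) (m : multinom 2) (z : R * R) :
  eval2 (mpolyX R m) z = z.1 ^+ (m ord0) * z.2 ^+ (m ord_max).
Proof. by rewrite mpolyX_xy eval2_xy. Qed.

Lemma measurable_eval2_mon (R : realType) (m : multinom 2) :
  measurable_fun [set: borel2 R] (fun z : borel2 R => eval2 (mpolyX R m) z).
Proof.
have := @measurable_mon R (m ord0) (m ord_max).
by apply: eq_measurable_fun => z _; rewrite eval2_mon.
Qed.

Lemma measurable_eval2 (R : realType) (q : poly2 R) :
  measurable_fun [set: borel2 R] (fun z : borel2 R => eval2 q z).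
Proof.
rewrite (_ : (fun z => _) =
    fun z : borel2 R => \sum_(m <- msupp q) mcoeff m q * eval2 (mpolyX R m) z).
  apply: measurable_sum => m; apply: measurable_funM => //.
  exact: measurable_eval2_mon.
apply/funext => z; rewrite {1}[q]mpolyE /eval2 raddf_sum /=.
by apply: eq_bigr => m _; rewrite mevalZ.
Qed.

(** The Dirac masses are added one at a time; restricting to nonnegative integrands
avoids integrability conditions in the induction. *)
Lemma finite_atomic_measure (R : realType) (s : seq (R * (R * R))) :
  (forall a, a \in s -> 0 <= a.1) ->
  exists mu : {measure set (borel2 R) -> \bar R},
    (forall A : set (borel2 R), (forall a, a \in s -> ~ A a.2) -> mu A = 0%E) /\
    forall f : borel2 R -> R, measurable_fun setT f -> (forall z, 0 <= f z) ->
      (\int[mu]_z (f z)%:E)%E = (\sum_(a <- s) a.1 * f a.2)%:E.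
Proof.
elim: s => [|a s IH] s0.
  by exists mzero; split=> // f mf f0; rewrite integral_measure_zero big_nil.
have [mu [mu0 muf]] := IH (fun x xs => s0 x (@mem_behead _ (a :: s) x xs)).
have a0 : 0 <= a.1 := s0 a (mem_head a s).
exists (measure_add (mscale (NngNum a0) (dirac (a.2 : borel2 R))) mu); split.
  move=> A As; transitivity (mscale (NngNum a0) (dirac (a.2 : borel2 R)) A + mu A)%E.
    exact: measure_addE.
  rewrite mu0; last first.
    by move=> x xs; apply: As; rewrite inE xs orbT.
  rewrite adde0 /mscale /= diracE memNset ?mule0 //.
  by apply: As; rewrite mem_head.
move=> f mf f0.
have mfE : measurable_fun setT (fun z => (f z)%:E) by exact/measurable_EFinP.
rewrite ge0_integral_measure_add //=; last by move=> z _; rewrite lee_fin.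
rewrite ge0_integral_mscale //=; last by move=> z _; rewrite lee_fin.
by rewrite integral_dirac // diracT mul1e muf // big_cons EFinD EFinM.
Qed.

(** The passage from nonnegative to arbitrary functions, by positive and negative
parts. *)
Lemma atomic_measure_integral (R : realType) (s : seq (R * (R * R)))
    (mu : {measure set (borel2 R) -> \bar R}) (f : borel2 R -> R) :
  (forall f : borel2 R -> R, measurable_fun setT f -> (forall z, 0 <= f z) ->
      (\int[mu]_z (f z)%:E)%E = (\sum_(a <- s) a.1 * f a.2)%:E) ->
  measurable_fun setT f ->
  mu.-integrable setT (fun z => (f z)%:E) /\
  (\int[mu]_z (f z)%:E)%E = (\sum_(a <- s) a.1 * f a.2)%:E.
Proof.
move=> mus mf; split.
  apply/integrableP; split; first exact/measurable_EFinP.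
  have := mus (fun z => `|f z|) (measurableT_comp (@normr_measurable R setT) mf) (fun z => normr_ge0 _).
  by move=> /= ->; rewrite ltry.
have pos : (\int[mu]_z (Num.max (f z) 0)%:E)%E = (\sum_(a <- s) a.1 * Num.max (f a.2) 0)%:E.
  apply: mus => [|z]; last by rewrite le_max lexx orbT.
  by apply: measurable_maxr.
have neg : (\int[mu]_z (Num.max (- f z) 0)%:E)%E = (\sum_(a <- s) a.1 * Num.max (- f a.2) 0)%:E.
  apply: mus => [|z]; last by rewrite le_max lexx orbT.
  by apply: measurable_maxr => //; apply: measurableT_comp.
rewrite integralE.
under eq_integral do rewrite funeposE -EFin_max.
under [X in (_ - X)%E]eq_integral do rewrite funenegE -EFinN -EFin_max.
rewrite pos neg -EFinB -sumrB; congr EFin; apply: eq_bigr => a _.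
by rewrite -mulrBr; congr (_ * _); rewrite !maxEle; case: (leP (f a.2) 0); case: (leP (- f a.2) 0); lra.
Qed.

Lemma KQ_curve (R : realType) (p : poly2 R) :
  KQ [:: 1; p; - p] = [set z | eval2 p z = 0].
Proof.
apply/seteqP; split=> z /=.
  move=> pz; apply/eqP; rewrite eq_le (pz p) ?inE ?eqxx ?orbT // andbT.
  rewrite -oppr_ge0 -mevalN.
  by apply: (pz (- p)); rewrite !inE eqxx !orbT.
move=> pz q; rewrite !inE => /or3P[] /eqP->.
- by rewrite /eval2 meval1.
- by rewrite pz.
- by rewrite /eval2 mevalN -/(eval2 p z) pz oppr0.
Qed.

Lemma atomic_representing (R : realType) (p : poly2 R) n (b : tseq R n) s :
  atomic_on p b s -> exists mu, representing_measure [:: 1; p; - p] b mu.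
Proof.
move=> [s0 bs].
have [mu [mu0 mus]] := finite_atomic_measure (fun a ain => proj1 (s0 a ain)).
exists mu; split.
  apply: mu0 => a /s0[_ pa]; apply; rewrite KQ_curve; exact: pa.
move=> m; rewrite bs.
have := atomic_measure_integral mus (measurable_eval2_mon m).
exact.
Qed.

(** * From a measure to atoms *)

Lemma measurable_curve (R : realType) (p : poly2 R) :
  measurable ([set z | eval2 p z = 0] : set (borel2 R)).
Proof.
have := @measurable_eval2 R p measurableT [set 0] (measurable_set1 _).
by rewrite setTI.
Qed.

Lemma integral_curve (R : realType) (p : poly2 R) (mu : {measure set (borel2 R) -> \bar R})
    (f : borel2 R -> R) :
  mu (~` [set z | eval2 p z = 0]) = 0%E ->
  mu.-integrable setT (fun z => (f z)%:E) ->
  (\int[mu]_(z in [set z | eval2 p z = 0%R]) (f z)%:E = \int[mu]_z (f z)%:E)%E.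
Proof.
move=> C0 fi; rewrite [RHS](negligible_integral _ _ fi C0) //.
  by rewrite setTD setCK.
by apply: measurableC; exact: measurable_curve.
Qed.

(** Let [t] be the monomial parameter of the curve. The functional on the line is
[L g = \int y ^ (2n) * g t], where [y ^ (2n) * t ^ k] is integrable for
[k <= 2d] by [curve_monomial_bound]. Its values on squares are integrals of
squares, so an isotropic polynomial vanishes at [t] almost everywhere; this also
gives the two closure conditions, since [t] has no zero on the curve. *)
Lemma measure_atomic (R : realType) l1 l2 n (b : tseq R n)
    (mu : {measure set (borel2 R) -> \bar R}) :
  let p := xy R l1 l2 - 1 in coprime l1 l2 -> (0 < l1)%N -> (0 < l2)%N ->
  representing_measure [:: 1; p; - p] b mu -> exists s, atomic_on p b s.
Proof.
move=> p co l1p l2p [C0 mub]; rewrite KQ_curve in C0.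
pose C : set (borel2 R) := [set z | eval2 p z = 0].
have mC : measurable C := measurable_curve p.
have [u [v tauP]] := @curve_parameter R _ _ co l1p l2p.
pose tau (z : borel2 R) : R := z.1 ^+ u * z.2 ^+ v.
have tauC z : C z -> z.1 = tau z ^+ l2 /\ z.2 * tau z ^+ l1 = 1.
  move=> Cz; apply: tauP; apply/eqP; rewrite -subr_eq0; apply/eqP.
  by rewrite -[RHS]Cz /p /eval2 mevalB meval1 -/(eval2 _ _) eval2_xy.
pose d := (n * (l1 + l2))%N.
pose phi k (z : borel2 R) : R := z.2 ^+ (2 * n) * tau z ^+ k.
have mphi k : measurable_fun setT (phi k).
  apply: measurable_funM; apply: measurable_funX.
    exact: measurable_coord2.
  exact: measurable_mon.
have intmon i j : (i + j <= 2 * n)%N ->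
    mu.-integrable setT (fun z : borel2 R => (z.1 ^+ i * z.2 ^+ j)%:E) /\
    (\int[mu]_z (z.1 ^+ i * z.2 ^+ j)%:E = (riesz b (xy R i j))%:E)%E.
  move=> /mon_xyP[m [<- <-]]; rewrite -riesz_xyE; have [mi mE] := mub m.
  have e : (fun z : borel2 R => (eval2 (mon_poly R m) z)%:E) =
      (fun z : borel2 R => (z.1 ^+ (m ord0) * z.2 ^+ (m ord_max))%:E).
    by apply/funext => z; rewrite eval2_mon.
  by rewrite e in mi mE.
have iphi k : (k <= d.*2)%N -> mu.-integrable C (fun z => (phi k z)%:E).
  move=> kd.
  (* The dominating function is [x ^ (2n) + y ^ (2n)], whose integrability is
     part of the hypothesis on the moments of degree [2n]. *)
  apply: (@le_integrable _ _ _ mu C mC _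
    (fun z => (z.1 ^+ (2 * n) * z.2 ^+ 0)%:E + (z.1 ^+ 0 * z.2 ^+ (2 * n))%:E)%E).
  - by apply/measurable_EFinP; apply: measurable_funTS.
  - move=> z Cz; rewrite -EFinD !expr0 mulr1 mul1r !abse_EFin lee_fin.
    have [zE z1] := tauC z Cz.
    apply: le_trans (ler_norm _).
    by apply: (curve_monomial_bound _ zE z1); rewrite mul2n.
  - apply: (@integrableS _ _ _ _ setT) => //.
    by apply: integrableD => //; apply: (proj1 (intmon _ _ _)); rewrite ?addn0 ?add0n.
have [L LX] := scalar_of_moments (fun k => fine (\int[mu]_(z in C) (phi k z)%:E)%E) d.*2.+1.
have LE (g : {poly R}) : (size g <= d.*2.+1)%N ->
    (\int[mu]_(z in C) (z.2 ^+ (2 * n) * g.[tau z])%:E = (L g)%:E)%E.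
  move=> sg.
  have kd (k : 'I_(size g)) : (k <= d.*2)%N.
    by rewrite -ltnS (leq_trans (ltn_ord k)).
  transitivity (\int[mu]_(z in C) \sum_(k < size g) ((g`_k)%:E * (phi k z)%:E))%E.
    apply: eq_integral => z _; rewrite horner_coef mulr_sumr -sumEFin.
    by apply: eq_bigr => k _; rewrite -EFinM; congr EFin; rewrite /phi; ring.
  rewrite integral_sum //; last by move=> k; apply/integrableZl/iphi.
  rewrite -[in RHS](mul1r g) scalar_mul_poly -sumEFin; apply: eq_bigr => k _.
  rewrite integralZl //; last exact: iphi.
  rewrite mul1r LX ?ltnS // EFinM fineK //.
  by apply: integrable_fin_num => //; exact: iphi.
have Lsq (g : {poly R}) : (size g <= d.+1)%N -> (size (g ^+ 2)%R <= d.*2.+1)%N.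
  move=> sg; rewrite expr2 (leq_trans (size_polyMleq _ _)) //.
  by case: (size g) sg => [|m] //= md; rewrite addnS -addnn ltnS leq_add.
have mpoly_tau (f : {poly R}) :
    measurable_fun C (fun z => (z.2 ^+ (2 * n) * f.[tau z])%:E).
  apply/measurable_EFinP; apply: measurable_funTS.
  have -> : (fun z : borel2 R => z.2 ^+ (2 * n) * f.[tau z]) =
      (fun z => \sum_(k < size f) f`_k * phi k z).
    apply/funext => z; rewrite horner_coef mulr_sumr.
    by apply: eq_bigr => k _; rewrite /phi; ring.
  by apply: measurable_sum => k; apply: measurable_funM.
have vanish (g f : {poly R}) : (size g <= d.+1)%N -> L (g ^+ 2) = 0 ->
    (size f <= d.*2.+1)%N ->
    (forall z, C z -> g.[tau z] = 0 -> f.[tau z] = 0) -> L f = 0.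
  move=> sg Lg sf gf; apply: EFin_inj; rewrite -LE //.
  rewrite (@ae_eq_integral _ _ _ mu C (cst 0%E)) ?integral0 //.
  have := LE _ (Lsq _ sg); rewrite Lg => int0.
  have /(ae_eq_integral_abs mu mC (mpoly_tau (g ^+ 2))) :
      (\int[mu]_(z in C) `|(z.2 ^+ (2 * n) * (g ^+ 2).[tau z])%:E| = 0)%E.
    rewrite -[RHS]int0; apply: eq_integral => z _.
    rewrite abse_EFin ger0_norm // horner_exp mulr_ge0 ?sqr_ge0 //.
    by rewrite exprM exprn_ge0 // sqr_ge0.
  apply: filterS => z gz Cz; have := gz Cz; have [_ z1] := tauC z Cz.
  have z20 : z.2 != 0.
    by apply/eqP => z20; move: z1; rewrite z20 mul0r => /esym/eqP; rewrite oner_eq0.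
  move=> zg; have {zg} /eqP := congr1 fine zg; rewrite /= mulf_eq0 expf_eq0 (negPf z20) andbF /=.
  rewrite horner_exp expf_eq0 /= => /eqP g0.
  by rewrite (gf z Cz g0) mulr0.
have Lge0 (g : {poly R}) : (size g <= d.+1)%N -> 0 <= L (g ^+ 2).
  move=> sg; rewrite -lee_fin -LE ?Lsq //; apply: integral_ge0 => z _.
  by rewrite lee_fin horner_exp mulr_ge0 ?sqr_ge0 // exprM exprn_ge0 // sqr_ge0.
have [g h sg Lg sgh|g sg Lg|xs [w [xs0 w0 Lxs]]] := truncated_moments_atomic Lge0.
- by apply: (vanish _ _ sg Lg sgh) => z _ gz; rewrite hornerM gz mul0r.
- apply: (vanish _ _ _ Lg).
  + by rewrite (leq_trans (size_polyMleq _ _)) // size_polyX.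
  + by rewrite Lsq // leqW.
  + move=> z Cz /eqP; rewrite hornerM hornerX mulf_eq0 => /orP[/eqP t0|/eqP gz].
      have [_] := tauC z Cz; rewrite t0 expr0n (gtn_eqF l1p) mulr0 => /esym/eqP.
      by rewrite oner_eq0.
    by rewrite horner_exp gz expr0n.
- apply: (atomic_of_line xs0 w0) => i j ij.
  have [ijint ijE] := intmon i j ij.
  set k := (l2 * i + _)%N.
  have kd : (k <= d.*2)%N := line_exponent_le l1 l2 ij.
  apply: EFin_inj; rewrite -ijE -(integral_curve C0 ijint).
  transitivity (L 'X^k)%:E; last first.
    rewrite Lxs ?size_polyXn //; congr EFin.
    by apply: eq_bigr => x _; rewrite hornerXn.
  rewrite -LE ?size_polyXn //; apply: eq_integral => z; rewrite inE => Cz.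
  have [zE z1] := tauC z Cz.
  by rewrite hornerXn (curve_monomial ij zE z1).
Qed.

End Measures.

(** * Property S for the curve *)

Theorem theorem4p1 (R : realType) (l1 l2 n : nat)
    (hl1 : (2 <= l1)%N) (hl2 : (2 <= l2)%N) (hcop : gcdn l1 l2 = 1%N)
    (hn : (l1 + l2 <= n)%N) :
  let p : poly2 R := varx R ^+ l1 * vary R ^+ l2 - 1 in
  property_S [:: 1; p; - p] n (l1 + l2 - 1).
Proof.
have co : coprime l1 l2 by rewrite /coprime hcop.
move=> p b; split=> [[mu mub]|[b' [ext loc]]].
  have [s bs] := measure_atomic co (ltnW hl1) (ltnW hl2) mub.
  by apply: (atomic_property bs); rewrite curve_deg2; lia.
have [s bs] := extension_atomic hl1 hl2 co ext (loc 1%N isT) (loc 2%N isT).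
exact: atomic_representing bs.
Qed.
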